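(* Let $p$ be an odd prime, let $q\in\mathbb{C}_p$ with $|1-q|_p<p^{-1/(p-1)}$, and let $h\in\mathbb{N}$. Let $s\in\mathbb{N}$ with $s\ge 2$, and let $n_1,n_2,\dots,n_s,k\in\mathbb{N}^{\ast}$ with $\sum_{l=1}^{s}n_l>sk$. Then $$\int_{\mathbb{Z}_p}\left(\prod_{i=1}^{s}B_{k,n_i}(x,q)\right)q^{(h-1)x}\,d\mu_{-q}(x)=\begin{cases}[2]_q+\dfrac{q^{h+1}}{n_1+\cdots+n_s+1}G_{n_1+\cdots+n_s+1,q^{-1}}^{(h)} & \text{if } k=0,\\[2mm] \displaystyle\prod_{i=1}^{s}\binom{n_i}{k}\sum_{l=0}^{sk}\binom{sk}{l}(-1)^{sk+l}\left([2]_q+\frac{q^{h+1}}{n_1+\cdots+n_s-l+1}G_{n_1+\cdots+n_s-l+1,q^{-1}}^{(h)}\right) & \text{if } k\neq0.\end{cases}$$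
   Context: Here $\mathbb{N}=\{1,2,\dots\}$, $\mathbb{N}^{\ast}=\mathbb{N}\cup\{0\}$; $\mathbb{C}_p$ is the completion of an algebraic closure of $\mathbb{Q}_p$ with absolute value normalized by $|p|_p=p^{-1}$. For $|x|_p\le 1$, $q^x=\exp(x\log q)$. Put $[x]_q=\frac{1-q^x}{1-q}$ (with $[x]_1=x$), so $[2]_q=1+q$, and $[x]_{-q}=\frac{1-(-q)^x}{1+q}$ for $x\in\mathbb{N}$. The fermionic $p$-adic $q$-integral of a uniformly differentiable $f:\mathbb{Z}_p\to\mathbb{C}_p$ is $$\int_{\mathbb{Z}_p}f(x)\,d\mu_{-q}(x)=\lim_{N\to\infty}\frac{1}{[p^N]_{-q}}\sum_{x=0}^{p^N-1}(-1)^xf(x)q^x.$$ The $(h,q)$-Genocchi polynomials are defined by $G_{0,q}^{(h)}(x)=0$ and $\frac{G_{n+1,q}^{(h)}(x)}{n+1}=\int_{\mathbb{Z}_p}q^{(h-1)y}[x+y]_q^n\,d\mu_{-q}(y)$ for $n\in\mathbb{N}^{\ast}$, $x\in\mathbb{Z}_p$; the $(h,q)$-Genocchi numbers are $G_{n,q}^{(h)}=G_{n,q}^{(h)}(0)$. $G_{n,q^{-1}}^{(h)}$ is obtained by replacing $q$ by $q^{-1}$ throughout. For $n,k\in\mathbb{N}^{\ast}$ and $x\in\mathbb{Z}_p$, the $q$-Bernstein polynomials are $B_{k,n}(x,q)=\binom{n}{k}[x]_q^k[1-x]_{q^{-1}}^{n-k}$ (with $\binom{n}{k}=0$ and $B_{k,n}=0$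 if $k>n$). *)

(* Defs.v *)
From HB Require Import structures.
From mathcomp Require Import all_boot all_order all_algebra.
From mathcomp Require Import all_classical all_reals topology.

Set Implicit Arguments.
Unset Strict Implicit.
Unset Printing Implicit Defensive.

Import Order.TTheory GRing.Theory Num.Theory.

Local Open Scope classical_set_scope.
Local Open Scope ring_scope.

Definition algebraic_over (K : fieldType) (A : set K) : set K :=
  [set x | exists P : {poly K}, [/\ P != 0, forall i, A P`_i & root P x]].

Definition algebraically_closed_set (K : fieldType) (A : set K) : Prop :=
  forall P : {poly K}, (forall i, A P`_i) -> (1 < size P)%N ->
    exists2 x, A x & root P x.

(* [padicComplexType R p]: the completion C_p of an algebraic closure of Q_p,
   with its absolute value (valued in the reals R).  Inside C_p, the field Q_p
   is the topological closure of Q: it is complete because C_p is, and the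
   absolute value restricts to the p-adic one on Q because it is ultrametric
   and sends p to 1/p.  The algebraic closure of Q_p is then the set of elements
   of C_p that are algebraic over Q_p; C_p is its completion because it is
   complete and contains it as a dense subset.
   MathComp's norm structures cannot be used for the absolute value: their axiom
   `|x *+ n| = `|x| *+ n is false p-adically. *)
HB.mixin Record isPadicComplex (R : realType) (p : nat) (K : Type)
    & GRing.Field K & Complete K & Metric R K := {
  padic_abs : K -> R ;
  mdist_padic_abs : forall x y : K, mdist x y = padic_abs (x - y) ;
  padic_absM : forall x y : K, padic_abs (x * y) = padic_abs x * padic_abs y ;
  padic_abs_ultra : forall x y : K,
    padic_abs (x + y) <= Num.max (padic_abs x) (padic_abs y) ;
  padic_abs_p : padic_abs p%:R = p%:R^-1 ;
  Qp_bar_closed :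
    algebraically_closed_set (algebraic_over (closure (range (@ratr K)))) ;
  Qp_bar_dense :
    closure (algebraic_over (closure (range (@ratr K)))) = [set: K]
}.

#[short(type="padicComplexType")]
HB.structure Definition PadicComplex (R : realType) (p : nat) :=
  {K of GRing.Field K & Complete K & Metric R K & isPadicComplex R p K}.

(* Loaded only now: [PadicComplex] and [PseudoMetricNormedZmod] have no common
   join in the hierarchy, so Hierarchy-Builder would reject the declaration of
   the former after that of the latter. *)
From mathcomp Require Import all_analysis.

Section Definitions.
Context {R : realType} {p : nat} {Cp : padicComplexType R p}.
Implicit Types (q x y : Cp) (f : Cp -> Cp) (h k n N : nat).

Definition padic_exp x : Cp := limn (series (fun n => x ^+ n / n`!%:R)).

Definition padic_log x : Cp :=
  limn (series (fun n => (-1) ^+ n * (x - 1) ^+ n.+1 / n.+1%:R)).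

(* q^x for x in C_p with |x| <= 1. *)
Definition qpow q x : Cp := padic_exp (x * padic_log q).

(* [x]_q *)
Definition qnum q x : Cp := if q == 1 then x else (1 - qpow q x) / (1 - q).

(* [m]_{-q} for a natural number m; the base -q is outside the domain of
   [qpow], so this uses ordinary powers. *)
Definition qnum_neg q (m : nat) : Cp := (1 - (- q) ^+ m) / (1 + q).

(* A function Z_p -> C_p is represented by a function on C_p, of which only the
   values at natural numbers matter here. *)
Definition fermionic_sum q f : Cp ^nat := fun N =>
  (qnum_neg q (p ^ N))^-1 *
    \sum_(0 <= x < p ^ N) (-1) ^+ x * f x%:R * q ^+ x.

(* Uniform differentiability of f, which guarantees convergence, is not
   required: the value is junk when the sums diverge. *)
Definition fermionic_integral q f : Cp := limn (fermionic_sum q f).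

Definition genocchi_poly h q n x : Cp :=
  if n is m.+1 then
    m.+1%:R * fermionic_integral q
      (fun y => qpow q ((h%:R - 1) * y) * qnum q (x + y) ^+ m)
  else 0.

Definition genocchi h q n : Cp := genocchi_poly h q n 0.

Definition bernstein k n x q : Cp :=
  'C(n, k)%:R * qnum q x ^+ k * qnum q^-1 (1 - x) ^+ (n - k).

End Definitions.

(* Main.v *)
Require Import Defs.
From HB Require Import structures.
From mathcomp Require Import all_boot all_order all_algebra.
From mathcomp Require Import all_classical all_reals all_analysis.
From mathcomp Require Import ring zify.

Import Order.TTheory GRing.Theory Num.Theory.
Import numFieldNormedType.Exports.

Local Open Scope classical_set_scope.
Local Open Scope ring_scope.

(** Write [[x]_q] for the q-integer and [E(g)] for the limit over [N] of the
    alternating sums of [(-1) ^+ x * g x] over [x < p ^ N].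

    At a natural number [x] one has [[1 - x]_{1/q} = 1 - [x]_q], so the product of
    the Bernstein polynomials is a product of binomial coefficients times
    [(1 - y) ^+ (s * k) * y ^+ (N - s * k)], where [y] is [[1 - x]_{1/q}] and [N] is the
    sum of the [n i]. Expanding the first power (lemma [prod_bernstein_expand])
    reduces the theorem by linearity to the integral of [y ^+ m] with weight
    [q ^ ((h - 1) x)], where [m = N - l] is positive because [s * k < N]. This is
    [cvg_fermionic_reflected_power].

    For that integral, put [g x = q ^+ (h * x) * (1 - [x]_q) ^+ m] and
    [g' y = q ^- (h * y) * [y]_{1/q} ^+ m]. The change of variable x = 1 - y turns
    [g] into [q ^+ h * g']; it does not preserve the interval [0, P[ with
    [P = p ^ N], but x = P + 1 - y maps it to [2, P + 2[ and is p-adically close to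
    x = 1 - y. As [P] is odd, moving the sum from [2, P + 2[ back to [0, P[ costs
    about [2 * g 1 - 2 * g 0 = - 2]. Hence [q ^+ h * E(g') = E(g) - 2]
    ([altsum_reflection]), which, multiplied by the limit of the normalizing
    factors ([cvg_fermionic_sum]), is the formula relating the integral of
    [y ^+ m] to a Genocchi number for [1/q].

    The alternating sums converge because [g] is uniformly continuous for the
    p-adic distance and [p] is odd: an interval of length [p ^ N.+1] consists of
    [p] blocks of length [p ^ N] with nearly equal sums and alternating signs
    ([altsum_blocks]). This treats [q = 1] and [q != 1] alike.

    All this takes place at integers, whereas [qpow] is defined by the p-adic
    exponential and logarithm, so that [qpow q m%:R = q ^+ m] has to be proved. It
    follows from exp(x + y) = exp(x) exp(y) and exp(log q) = q. Both are identities
    of formal power series, here applied to truncations, which are polynomials: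
    the difference of the two sides has no coefficient below the truncation
    order, and the Gauss norm, controlled by Legendre's bound on the valuation of
    [n!], shows that its value tends to 0 ([gauss_le_horner_tail], [padic_expD],
    [padic_expK]). *)

(** * The p-adic absolute value and limits *)

Section PadicAbs.
Context {R : realType} {p : nat} {Cp : padicComplexType R p}.
Implicit Types (x y z l : Cp) (u v : Cp ^nat) (e : R ^nat).
Local Notation abs := (@padic_abs R p Cp).

Lemma abs_ge0 x : 0 <= abs x.
Proof. by rewrite -[x]subr0 -mdist_padic_abs mdist_ge0. Qed.

Lemma abs0 : abs 0 = 0.
Proof. by rewrite -[X in abs X](subrr 0) -mdist_padic_abs mdistxx. Qed.

Lemma abs_eq0 x : (abs x == 0) = (x == 0).
Proof.
apply/eqP/eqP => [x0|->]; last exact: abs0.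
by apply: (@mdist_positivity R Cp); rewrite mdist_padic_abs subr0.
Qed.

Lemma abs_gt0 x : (0 < abs x) = (x != 0).
Proof. by rewrite lt0r abs_eq0 abs_ge0 andbT. Qed.

Lemma abs_distC x y : abs (x - y) = abs (y - x).
Proof. by rewrite -!mdist_padic_abs metric_sym. Qed.

Lemma absN x : abs (- x) = abs x.
Proof. by rewrite -sub0r abs_distC subr0. Qed.

Lemma abs1 : abs 1 = 1.
Proof.
have a0 : abs 1 != 0 by rewrite abs_eq0 oner_neq0.
by apply: (mulfI a0); rewrite mulr1 -padic_absM mulr1.
Qed.

Lemma absX x m : abs (x ^+ m) = abs x ^+ m.
Proof. by elim: m => [|m IH]; rewrite ?expr0 ?abs1// !exprS padic_absM IH. Qed.

Lemma absV x : abs x^-1 = (abs x)^-1.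
Proof.
have [->|x0] := eqVneq x 0; first by rewrite invr0 abs0 invr0.
have a0 : abs x != 0 by rewrite abs_eq0.
by apply: (mulfI a0); rewrite mulfV// -padic_absM mulfV// abs1.
Qed.

Lemma absf x y : abs (x / y) = abs x / abs y.
Proof. by rewrite padic_absM absV. Qed.

Lemma abs_signM m x : abs ((-1) ^+ m * x) = abs x.
Proof. by rewrite padic_absM absX absN abs1 expr1n mul1r. Qed.

Lemma absD_le x y (c : R) : abs x <= c -> abs y <= c -> abs (x + y) <= c.
Proof. by move=> xc yc; apply: le_trans (padic_abs_ultra _ _) _; rewrite ge_max xc. Qed.

Lemma absB_le x y (c : R) : abs x <= c -> abs y <= c -> abs (x - y) <= c.
Proof. by move=> xc yc; apply: absD_le; rewrite ?absN. Qed.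

Lemma absD_lt x y (c : R) : abs x < c -> abs y < c -> abs (x + y) < c.
Proof. by move=> xc yc; apply: le_lt_trans (padic_abs_ultra _ _) _; rewrite gt_max xc. Qed.

Lemma abs_dist_le_trans y x z (c : R) :
  abs (x - y) <= c -> abs (y - z) <= c -> abs (x - z) <= c.
Proof. by move=> xy yz; rewrite -(subrKA y); exact: absD_le. Qed.

Lemma abs_sum_le (I : eqType) (s : seq I) (P : pred I) (F : I -> Cp) (c : R) :
    0 <= c -> (forall i, i \in s -> P i -> abs (F i) <= c) ->
  abs (\sum_(i <- s | P i) F i) <= c.
Proof.
move=> c0 Fc; rewrite big_seq_cond.
apply: (big_ind (fun x => abs x <= c)) => [|x y|i /andP[]]; last exact: Fc.
- by rewrite abs0.
- exact: absD_le.
Qed.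

Lemma absM_le1 x y : abs x <= 1 -> abs y <= 1 -> abs (x * y) <= 1.
Proof. by move=> x1 y1; rewrite padic_absM mulr_ile1 ?abs_ge0. Qed.

Lemma absX_le1 x m : abs x <= 1 -> abs (x ^+ m) <= 1.
Proof. by move=> x1; rewrite absX exprn_ile1 ?abs_ge0. Qed.

Lemma abs_nat_le1 m : abs m%:R <= 1.
Proof. by elim: m => [|m IH]; rewrite ?abs0// mulrSr absD_le// abs1. Qed.

Lemma abs_near1 x : abs (1 - x) < 1 -> abs x = 1.
Proof.
move=> x1; apply/eqP; rewrite eq_le; apply/andP; split.
  by rewrite -(subKr 1 x) absB_le ?abs1// ltW.
rewrite leNgt; apply/negP => x1'.
by have := absD_lt _ _ _ x1 x1'; rewrite subrK abs1 ltxx.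
Qed.

Section Limits.

Lemma cvg_absP u l :
  (u @ \oo --> l) <-> ((fun m => abs (u m - l)) @ \oo --> (0 : R)).
Proof.
split=> [ul|ul].
  apply/cvgrPdist_lt => e e0.
  have /cvg_ballP/(_ e e0) := ul; apply: filterS => m.
  by rewrite ballEmdist/= mdist_padic_abs sub0r normrN ger0_norm ?abs_ge0// abs_distC.
apply/cvg_ballP => e e0.
have /cvgrPdist_lt/(_ e e0) := ul; apply: filterS => m.
by rewrite ballEmdist/= mdist_padic_abs sub0r normrN ger0_norm ?abs_ge0// abs_distC.
Qed.

Lemma cvg_abs_le e u l : (forall m, abs (u m - l) <= e m) ->
  e @ \oo --> (0 : R) -> u @ \oo --> l.
Proof.
move=> ue e0; apply/cvg_absP; move: e0; apply: squeeze_cvgr; last exact: cvg_cst.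
by apply: nearW => m; rewrite abs_ge0 ue.
Qed.

Lemma padic_cvg_lim u l : u @ \oo --> l -> limn u = l.
Proof. by move=> ul; exact: (cvg_lim (@metric_hausdorff R Cp)). Qed.

Lemma padic_cvg_unique u l l' : u @ \oo --> l -> u @ \oo --> l' -> l = l'.
Proof. by move=> ul ul'; rewrite -(padic_cvg_lim _ _ ul) (padic_cvg_lim _ _ ul'). Qed.

Lemma padic_cvgD u v l l' : u @ \oo --> l -> v @ \oo --> l' ->
  (fun m => u m + v m) @ \oo --> l + l'.
Proof.
move=> /cvg_absP ul /cvg_absP vl.
apply: (cvg_abs_le (fun m => abs (u m - l) + abs (v m - l'))).
  move=> m; rewrite opprD addrACA.
  by rewrite absD_le// ?lerDl ?lerDr abs_ge0.
by rewrite -[0](addr0 0); apply: cvgD.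
Qed.

Lemma padic_cvgMl z u l : u @ \oo --> l -> (fun m => z * u m) @ \oo --> z * l.
Proof.
move=> /cvg_absP ul; apply: (cvg_abs_le (fun m => abs z * abs (u m - l))).
  by move=> m; rewrite -mulrBr padic_absM.
by rewrite -[0](mulr0 (abs z)); apply: cvgM => //; exact: cvg_cst.
Qed.

(** The usual splitting of [u m * v m - l * l'], with [u m] as a cofactor of the
    second difference. *)
Lemma padic_cvgM u v l l' : (forall m, abs (u m) <= 1) ->
  u @ \oo --> l -> v @ \oo --> l' -> (fun m => u m * v m) @ \oo --> l * l'.
Proof.
move=> u1 /cvg_absP ul /cvg_absP vl.
apply: (cvg_abs_le (fun m => abs (v m - l') + abs l' * abs (u m - l))).
  move=> m; have -> : u m * v m - l * l' = u m * (v m - l') + l' * (u m - l).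
    by ring.
  apply: absD_le; rewrite padic_absM.
    by rewrite (@le_trans _ _ (abs (v m - l')))// ?ler_piMl ?abs_ge0// lerDl mulr_ge0 ?abs_ge0.
  by rewrite lerDr abs_ge0.
rewrite -[0](addr0 0); apply: cvgD => //.
by rewrite -[0](mulr0 (abs l')); apply: cvgM => //; exact: cvg_cst.
Qed.

Lemma padic_cvg_sum (r : seq nat) (u : nat -> Cp ^nat) (l : nat -> Cp) :
  (forall i, i \in r -> u i @ \oo --> l i) ->
  (fun m => \sum_(i <- r) u i m) @ \oo --> \sum_(i <- r) l i.
Proof.
elim: r => [|i r IH] ul.
  by rewrite big_nil; under eq_cvg do rewrite big_nil; exact: cvg_cst.
rewrite big_cons; under eq_cvg do rewrite big_cons.
by apply: padic_cvgD => [|]; [apply: ul; rewrite mem_head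
  |apply: IH => j jr; apply: ul; rewrite inE jr orbT].
Qed.

Lemma cvg_geomR (a c : R) : 0 <= c -> c < 1 -> (fun m => a * c ^+ m) @ \oo --> (0 : R).
Proof. by move=> c0 c1; apply: (@cvg_geometric R a c); rewrite ger0_norm. Qed.

Lemma abs_lim_le u l (c : R) :
  u @ \oo --> l -> (forall m, abs (u m) <= c) -> abs l <= c.
Proof.
move=> /cvg_absP/cvgrPdist_lt ul uc; rewrite leNgt; apply/negP => cl.
have l0 : 0 < abs l by apply: le_lt_trans cl; exact: le_trans (abs_ge0 _) (uc 0%N).
have [m _ /(_ m (leqnn m))] := ul _ l0.
rewrite /= sub0r normrN ger0_norm ?abs_ge0// abs_distC => h.
have := absD_lt _ _ _ h (le_lt_trans (uc m) cl).
by rewrite subrK ltxx.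
Qed.

(** In an ultrametric space the distance between two terms of a sequence is at
    most the largest of the consecutive distances between them. *)
Lemma padic_cvg_of_consecutive u (a c : R) : 0 <= a -> 0 <= c -> c < 1 ->
  (forall m, abs (u m.+1 - u m) <= a * c ^+ m) -> cvgn u.
Proof.
move=> a0 c0 c1 uc.
have tail m j : abs (u (m + j)%N - u m) <= a * c ^+ m.
  elim: j => [|j IH]; first by rewrite addn0 subrr abs0 mulr_ge0// exprn_ge0.
  apply: (abs_dist_le_trans (u (m + j)%N)) => //; rewrite addnS.
  by apply: le_trans (uc _) _; rewrite ler_wpM2l// ler_wiXn2l ?leq_addr// ltW.
apply: cauchy_cvg; apply: cauchy_exP => e e0.
have /cvgrPdist_lt/(_ e e0) [m _ /(_ m (leqnn m))] := cvg_geomR a c c0 c1.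
rewrite /= sub0r normrN ger0_norm ?mulr_ge0 ?exprn_ge0// => me.
exists (u m); exists m => // j /= mj.
rewrite ballEmdist/= mdist_padic_abs abs_distC -(subnKC mj).
exact: le_lt_trans (tail _ _) me.
Qed.

Lemma padic_series_cvg u (a c : R) : 0 <= a -> 0 <= c -> c < 1 ->
  (forall m, abs (u m) <= a * c ^+ m) -> cvgn (series u).
Proof.
move=> a0 c0 c1 uc; apply: (padic_cvg_of_consecutive _ _ _ a0 c0 c1) => m.
by rewrite /series/= big_nat_recr//= addrAC subrr add0r.
Qed.

End Limits.
End PadicAbs.

(** * Valuations of factorials and the Gauss norm *)

(** Legendre's bound.  Bounding [n %/ p ^ K] from below by [p] times
    the next quotient, the sum of the quotients telescopes; keeping a final term of
    at least 1 gives the strict inequality. *)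
Lemma logn_fact_lt (p n : nat) : prime p -> (0 < n)%N ->
  (logn p n`! * p.-1 < n)%N.
Proof.
move=> p_prime n0; have p1 := prime_gt1 p_prime.
rewrite logn_fact//.
have telescope K :
    ((\sum_(1 <= k < K.+1) n %/ p ^ k) * p.-1 + maxn 1 (n %/ p ^ K) <= n)%N.
  elim: K => [|K IH]; first by rewrite big_geq// mul0n add0n expn0 divn1 geq_max n0 leqnn.
  rewrite big_nat_recr//= expnSr divnMA.
  have := leq_divM (n %/ p ^ K) p.
  move: IH; set S := (\sum_(1 <= k < K.+1) _)%N; set a := (n %/ p ^ K)%N.
  set b := (a %/ p)%N => IH ba.
  have -> : ((S + b) * p.-1 + maxn 1 b = S * p.-1 + (b * p.-1 + maxn 1 b))%N by lia.
  apply: leq_trans IH; rewrite leq_add2l.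
  have : (b * p.-1 + b = b * p)%N by rewrite -mulnSr prednK// ltnW.
  by case: b ba => [|b] ba; lia.
apply: leq_trans (telescope n); rewrite -addn1 leq_add2l.
exact: leq_maxl.
Qed.

Section Gauss.
Context {R : realType} {p : nat} {Cp : padicComplexType R p}.
Implicit Types (P Q : {poly Cp}) (c a b : R).
Local Notation abs := (@padic_abs R p Cp).

(** The Gauss norm of [P] on the disc of radius [c^-1] is at most [a].  The Gauss
    norm is submultiplicative, which makes it the right tool for estimating
    products and substitutions of truncated power series. *)
Definition gauss_le c a P := forall i, abs P`_i <= a * c ^+ i.

Lemma gauss_le_ge0 c a P : gauss_le c a P -> 0 <= a.
Proof. by move=> /(_ 0%N); rewrite mulr1; apply: le_trans; exact: abs_ge0. Qed.

Lemma gauss_leB c a P Q : gauss_le c a P -> gauss_le c a Q -> gauss_le c a (P - Q).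
Proof. by move=> Pa Qa i; rewrite coefB absB_le. Qed.

Lemma gauss_leM c a b P Q : 0 <= c ->
  gauss_le c a P -> gauss_le c b Q -> gauss_le c (a * b) (P * Q).
Proof.
move=> c0 Pa Qb i; rewrite coefM.
apply: abs_sum_le => [|j _ _].
  by rewrite !mulr_ge0 ?exprn_ge0 ?(gauss_le_ge0 _ _ _ Pa) ?(gauss_le_ge0 _ _ _ Qb).
have ji : (j <= i)%N by rewrite -ltnS ltn_ord.
rewrite padic_absM.
have -> : c ^+ i = c ^+ j * c ^+ (i - j) by rewrite -exprD subnKC.
rewrite mulrACA.
by apply: ler_pM; rewrite ?abs_ge0.
Qed.

Lemma gauss_leX c a P n : 0 <= c -> gauss_le c a P -> gauss_le c (a ^+ n) (P ^+ n).
Proof.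
move=> c0 Pa; elim: n => [|n IH]; last by rewrite !exprS; exact: gauss_leM.
move=> [|i]; rewrite coef1/= ?abs1 ?abs0 ?expr0 ?mulr1// mul1r exprn_ge0//.
Qed.

Lemma gauss_le_sum c a n (F : 'I_n -> {poly Cp}) : 0 <= a -> 0 <= c ->
  (forall i, gauss_le c a (F i)) -> gauss_le c a (\sum_(i < n) F i).
Proof.
move=> a0 c0 Fa j; rewrite coef_sum; apply: abs_sum_le => [|i _ _].
  by rewrite mulr_ge0 ?exprn_ge0.
exact: Fa.
Qed.

(** [Q] maps the disc of radius [c'^-1] into the disc of radius [b], which lies in
    the disc of radius [c^-1] on which [P] is bounded by [a]. *)
Lemma gauss_le_comp c c' a b P Q : 0 <= c -> 0 <= c' -> c * b <= 1 ->
  gauss_le c a P -> gauss_le c' b Q -> gauss_le c' a (P \Po Q).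
Proof.
move=> c0 c'0 cb Pa Qb.
have [a0 b0] := (gauss_le_ge0 _ _ _ Pa, gauss_le_ge0 _ _ _ Qb).
rewrite comp_polyE; apply: gauss_le_sum => // i j.
rewrite coefZ padic_absM (@le_trans _ _ (a * c ^+ i * (b ^+ i * c' ^+ j)))//.
  by apply: ler_pM; rewrite ?abs_ge0//; exact: gauss_leX.
have -> : a * c ^+ i * (b ^+ i * c' ^+ j) = (c * b) ^+ i * (a * c' ^+ j).
  by rewrite exprMn; ring.
by rewrite ler_piMl ?mulr_ge0 ?exprn_ge0// exprn_ile1// mulr_ge0.
Qed.

(** Polynomials that agree below degree [M] have close values inside the disc. *)
Lemma gauss_le_horner_tail c a P M (t : Cp) : 0 <= c -> c * abs t <= 1 ->
  gauss_le c a P -> (forall i, (i < M)%N -> P`_i = 0) ->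
  abs P.[t] <= a * (c * abs t) ^+ M.
Proof.
move=> c0 ct1 Pa PM; have ct0 : 0 <= c * abs t by rewrite mulr_ge0 ?abs_ge0.
have a0 := gauss_le_ge0 _ _ _ Pa.
rewrite horner_coef; apply: abs_sum_le => [|i _ _]; first by rewrite mulr_ge0 ?exprn_ge0.
have [iM|Mi] := ltnP i M; first by rewrite PM// mul0r abs0 mulr_ge0 ?exprn_ge0.
rewrite padic_absM absX (@le_trans _ _ (a * c ^+ i * abs t ^+ i))//.
  by rewrite ler_wpM2r// exprn_ge0 ?abs_ge0.
by rewrite -mulrA -exprMn ler_wpM2l// ler_wiXn2l.
Qed.

End Gauss.

(** * The p-adic exponential *)

Section PadicExp.
Context {R : realType} {p : nat} {Cp : padicComplexType R p}.
Hypothesis p_prime : prime p.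
Implicit Types (x y t : Cp).
Local Notation abs := (@padic_abs R p Cp).

(** The radius of convergence of the exponential series. *)
Definition exp_radius : R := p%:R `^ (- (p%:R - 1)^-1).
Local Notation r := exp_radius.

Let p_gt1 : (1 < p)%N := prime_gt1 p_prime.
Let pR_gt0 : (0 : R) < p%:R. Proof. by rewrite ltr0n ltnW. Qed.

Lemma exp_radius_gt0 : 0 < r. Proof. exact: powR_gt0. Qed.
Let r_gt0 := exp_radius_gt0.
Let rV_ge0 : 0 <= r^-1. Proof. by rewrite invr_ge0 ltW. Qed.

Lemma exp_radius_expr : r ^+ p.-1 = p%:R^-1.
Proof.
rewrite -powR_mulrn ?ltW// -powRrM -(powR_inv1 (ltW pR_gt0)); congr (_ `^ _).
have -> : (p.-1%:R : R) = p%:R - 1 by rewrite -subn1 natrB// ltnW.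
by rewrite mulNr mulVf// subr_eq0 gt_eqF// ltr1n.
Qed.

Lemma exp_radius_lt1 : r < 1.
Proof.
have p'_gt0 : (0 < p.-1)%N by lia.
by rewrite -(expr_lt1 p'_gt0 (ltW r_gt0)) exp_radius_expr invf_lt1// ltr1n.
Qed.

Lemma exp_radiusV_ge1 : 1 <= r^-1.
Proof. by rewrite invf_ge1// ltW// exp_radius_lt1. Qed.

Lemma abs_p_lt1 : abs (p%:R : Cp) < 1.
Proof. by rewrite padic_abs_p invf_lt1// ltr1n. Qed.

(** Otherwise a Bezout relation between [m] and [p] would write 1 as a sum of two
    terms of absolute value less than 1. *)
Lemma abs_nat_coprime m : coprime p m -> abs m%:R = 1.
Proof.
move=> pm; apply/eqP; rewrite eq_le abs_nat_le1/= leNgt; apply/negP => m1.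
case: (egcdnP m (prime_gt0 p_prime)) => a b bezout _.
have e : a%:R * p%:R - b%:R * m%:R = 1 :> Cp.
  by rewrite -!natrM bezout (eqP pm) natrD addrAC subrr add0r.
have : abs (a%:R * p%:R - b%:R * m%:R : Cp) < 1.
  apply: absD_lt; rewrite ?absN padic_absM.
    by apply: le_lt_trans abs_p_lt1; rewrite ler_piMl ?abs_ge0 ?abs_nat_le1.
  by apply: le_lt_trans m1; rewrite ler_piMl ?abs_ge0 ?abs_nat_le1.
by rewrite e abs1 ltxx.
Qed.

Lemma abs_nat m : (0 < m)%N -> abs m%:R = p%:R^-1 ^+ logn p m.
Proof.
move=> m0; have [m' cop {1}->] := pfactor_coprime p_prime m0.
by rewrite natrM natrX padic_absM absX padic_abs_p abs_nat_coprime ?mul1r.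
Qed.

Lemma natr_padic_neq0 m : (0 < m)%N -> m%:R != 0 :> Cp.
Proof. by move=> m0; rewrite -abs_gt0 abs_nat// exprn_gt0// invr_gt0. Qed.

(** The exponent [n.-1], rather than [n], is what keeps the logarithm inside the
    disc of convergence of the exponential. *)
Lemma abs_fact_ge n : r ^+ n.-1 <= abs (n`!%:R : Cp).
Proof.
have [->|n0] := posnP n; first by rewrite expr0 abs1.
rewrite abs_nat ?fact_gt0// -exp_radius_expr -exprM.
apply: ler_wiXn2l; rewrite ?ltW ?exp_radius_lt1//.
by have := logn_fact_lt p n p_prime n0; rewrite mulnC; lia.
Qed.

Lemma abs_nat_ge n : r ^+ n <= abs (n.+1%:R : Cp).
Proof.
apply: le_trans (abs_fact_ge n.+1) _.
by rewrite factS natrM padic_absM ler_piMr ?abs_ge0 ?abs_nat_le1.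
Qed.

Lemma abs_invr_le x n : r ^+ n <= abs x -> abs x^-1 <= r^-1 ^+ n.
Proof. by move=> xn; rewrite absV exprVn lef_pV2// posrE ?exprn_gt0// (lt_le_trans _ xn) ?exprn_gt0. Qed.

Lemma abs_exp_term_le x n : abs (x ^+ n / n`!%:R) <= (r^-1 * abs x) ^+ n.
Proof.
rewrite padic_absM absX exprMn mulrC ler_wpM2r ?exprn_ge0 ?abs_ge0//.
apply: le_trans (abs_invr_le _ _ (abs_fact_ge n)) _.
by rewrite ler_weXn2l ?exp_radiusV_ge1// leq_pred.
Qed.

Let ratio_lt1 x : abs x < r -> r^-1 * abs x < 1.
Proof. by move=> xr; rewrite mulrC ltr_pdivrMr// mul1r. Qed.

Let ratio_ge0 x : 0 <= r^-1 * abs x.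
Proof. by rewrite mulr_ge0 ?abs_ge0. Qed.

Lemma padic_exp_cvg x : abs x < r ->
  series (fun n => x ^+ n / n`!%:R) @ \oo --> padic_exp x.
Proof.
move=> xr; apply: (padic_series_cvg _ 1 (r^-1 * abs x)) => //; first exact: ratio_lt1.
by move=> m; rewrite mul1r abs_exp_term_le.
Qed.

Lemma padic_exp0 : padic_exp (0 : Cp) = 1.
Proof.
apply: (padic_cvg_unique _ _ _ (padic_exp_cvg 0 _)); first by rewrite abs0.
rewrite -cvg_shiftS; under eq_cvg => n.
  rewrite /series/= big_nat_recl// expr0 fact0 divr1 big1 ?addr0; last first.
    by move=> i _; rewrite expr0n mul0r.
  over.
exact: cvg_cst.
Qed.

(** A truncation of the series of exp(x T) in the variable T; the partial sums of
    [padic_exp x] are its values at 1, those of [padic_exp] at other points are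
    values of [exp_poly 1 M]. *)
Definition exp_poly x M : {poly Cp} := \poly_(i < M) (x ^+ i / i`!%:R).

Lemma gauss_le_exp_poly (c : R) x M : 0 <= c -> r^-1 * abs x <= c -> gauss_le c 1 (exp_poly x M).
Proof.
move=> c0 xc i; rewrite coef_poly; case: ifP => _; last by rewrite abs0 mul1r exprn_ge0.
by rewrite mul1r (le_trans (abs_exp_term_le _ _))// lerXn2r ?nnegrE.
Qed.

Lemma horner1_exp_poly x M : (exp_poly x M).[1] = series (fun n => x ^+ n / n`!%:R) M.
Proof.
rewrite /exp_poly horner_poly /series/= big_mkord.
by apply: eq_bigr => i _; rewrite expr1n mulr1.
Qed.

(** The polynomials [exp_poly x M * exp_poly y M] and [exp_poly (x + y) M]
    agree below degree [M] by the binomial formula, and on the disc of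
    convergence the remaining terms are geometrically small. *)
Lemma padic_expD x y : abs x < r -> abs y < r ->
  padic_exp (x + y) = padic_exp x * padic_exp y.
Proof.
move=> xr yr; pose c := r^-1 * Num.max (abs x) (abs y).
have c0 : 0 <= c by rewrite mulr_ge0// le_max abs_ge0.
have c1 : c < 1 by rewrite /c mulrC ltr_pdivrMr// mul1r gt_max xr.
have xc : r^-1 * abs x <= c by rewrite ler_wpM2l// le_max lexx.
have yc : r^-1 * abs y <= c by rewrite ler_wpM2l// le_max lexx orbT.
have xyc : r^-1 * abs (x + y) <= c by rewrite ler_wpM2l// padic_abs_ultra.
have xyr : abs (x + y) < r by exact: absD_lt.
have bnd z : r^-1 * abs z <= c -> forall M, abs (series (fun n => z ^+ n / n`!%:R) M) <= 1.
  move=> zc M; apply: abs_sum_le => // i _ _.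
  by rewrite (le_trans (abs_exp_term_le _ _))// exprn_ile1// (le_trans zc)// ltW.
apply: (padic_cvg_unique _ _ _ (padic_exp_cvg _ xyr)).
have cvgM := padic_cvgM _ _ _ _ (bnd x xc) (padic_exp_cvg _ xr) (padic_exp_cvg _ yr).
pose d M := exp_poly x M * exp_poly y M - exp_poly (x + y) M.
have d0 : (fun M => - (d M).[1]) @ \oo --> (0 : Cp).
  apply: (cvg_abs_le (fun M => 1 * c ^+ M)); last exact: cvg_geomR.
  move=> M; rewrite subr0 absN.
  have := gauss_le_horner_tail c 1 (d M) M 1 c0.
  rewrite abs1 mulr1; apply; first exact: ltW.
    apply: gauss_leB; last exact: gauss_le_exp_poly.
    by rewrite -[1]mulr1; apply: gauss_leM => //; exact: gauss_le_exp_poly.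
  move=> i iM; rewrite coefB coefM coef_poly iM addrC exprDn mulr_suml.
  apply/eqP; rewrite addrC subr_eq0; apply/eqP.
  rewrite (reindex_inj rev_ord_inj)/=; apply: eq_bigr => j _.
  have ji : (j <= i)%N by rewrite -ltnS.
  rewrite subSS subKn// !coef_poly (leq_ltn_trans (leq_subr _ _) iM) (leq_ltn_trans ji iM).
  rewrite -[_ *+ 'C(i, j)]mulr_natr.
  have nz k : k`!%:R != 0 :> Cp by rewrite natr_padic_neq0// fact_gt0.
  have -> : 'C(i, j)%:R = i`!%:R / (j`!%:R * (i - j)`!%:R) :> Cp.
    by rewrite -(bin_fact ji) !natrM mulfK// mulf_neq0.
  by field; rewrite !nz.
have := padic_cvgD _ _ _ _ cvgM d0; rewrite addr0; apply: cvg_trans.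
apply: near_eq_cvg; apply: nearW => M /=.
by rewrite /d hornerD hornerN hornerM !horner1_exp_poly; ring.
Qed.

End PadicExp.

(** * The p-adic logarithm and q-powers *)

Section PadicLog.
Context {R : realType} {p : nat} {Cp : padicComplexType R p}.
Hypothesis p_prime : prime p.
Implicit Types (x y t : Cp).
Local Notation abs := (@padic_abs R p Cp).
Local Notation r := (@exp_radius R p).

Let r_gt0 : 0 < r := exp_radius_gt0 p_prime.
Let rV_ge0 : 0 <= r^-1. Proof. by rewrite invr_ge0 ltW. Qed.

(** A truncation of the series of log(1 + T). *)
Definition log_poly M : {poly Cp} := 'X * \poly_(i < M) ((-1) ^+ i / i.+1%:R).

Lemma horner_log_poly t M :
  (log_poly M).[t] = series (fun n => (-1) ^+ n * t ^+ n.+1 / n.+1%:R) M.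
Proof.
rewrite /log_poly mulrC hornerMX horner_poly /series/= big_mkord mulr_suml.
by apply: eq_bigr => i _; rewrite exprSr mulrA !(mulrAC _ _^-1).
Qed.

Lemma gauss_le_log_poly M : gauss_le r^-1 r (log_poly M).
Proof.
move=> [|i]; rewrite coefXM /=; first by rewrite abs0 expr0 mulr1 ltW.
rewrite coef_poly; case: ifP => _; last by rewrite abs0 mulr_ge0 ?exprn_ge0 ?ltW ?invr_gt0.
rewrite abs_signM exprS mulrA divff ?mul1r ?gt_eqF//.
exact: (abs_invr_le p_prime _ _ (abs_nat_ge p_prime _)).
Qed.

Lemma deriv_log_poly M j : (j < M)%N -> (log_poly M)^`()`_j = (-1) ^+ j.
Proof.
move=> jM; rewrite coef_deriv coefXM/= coef_poly jM -[_ *+ _]mulr_natr divfK//.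
exact: natr_padic_neq0.
Qed.

(** The derivative of log(1 + T) is the geometric series of 1 / (1 + T). *)
Lemma deriv_log_poly_mul M j : (j < M)%N ->
  ((1 + 'X) * (log_poly M)^`())`_j = (j == 0%N)%:R.
Proof.
move=> jM; rewrite mulrDl mul1r coefD coefXM deriv_log_poly//.
case: j jM => [|j] jM /=; first by rewrite addr0.
by rewrite deriv_log_poly ?exprS ?mulN1r ?addNr// ltnW.
Qed.

Lemma eq_coefM_low (A B C : {poly Cp}) M : (forall i, (i < M)%N -> A`_i = B`_i) ->
  forall i, (i < M)%N -> (A * C)`_i = (B * C)`_i.
Proof.
move=> AB i iM; rewrite !coefM; apply: eq_bigr => j _; congr (_ * _).
by apply: AB; apply: leq_trans iM; rewrite ltnS -ltnS.
Qed.

Local Notation E M := (exp_poly (1 : Cp) M).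

Lemma deriv_exp_poly M : (E M.+1)^`() = E M.
Proof.
apply/polyP => i; rewrite coef_deriv !coef_poly ltnS; case: ifP => _; last by rewrite mul0rn.
have nz k : (0 < k)%N -> k%:R != 0 :> Cp by exact: natr_padic_neq0.
rewrite !expr1n !div1r factS natrM -[_ *+ _]mulr_natr.
by rewrite invfM mulrAC mulVf ?mul1r ?nz.
Qed.

(** The derivative of [E M.+1] is [E M], which differs from it by a multiple of
    ['X^M]; after substitution of [log_poly M], this is a multiple of ['X^M] again. *)
Lemma comp_exp_log_deriv M j : (j < M)%N ->
  ((1 + 'X) * (E M.+1 \Po log_poly M)^`())`_j = (E M.+1 \Po log_poly M)`_j.
Proof.
move=> jM; rewrite deriv_comp deriv_exp_poly mulrCA mulrC.
rewrite (eq_coefM_low _ 1 _ M) ?mul1r//; last first.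
  by move=> i iM; rewrite deriv_log_poly_mul// coef1.
have -> : E M.+1 = E M + (M`!%:R^-1) *: 'X^M.
  apply/polyP => i; rewrite coefD !coef_poly coefZ coefXn ltnS leq_eqVlt expr1n div1r.
  by case: eqVneq => [->|]; rewrite ?ltnn ?mulr1 ?add0r// mulr0 addr0.
rewrite comp_polyD coefD comp_polyZ coefZ comp_Xn_poly.
by rewrite /log_poly exprMn coefXnM jM mulr0 addr0.
Qed.

(** This is exp(log(1 + T)) = 1 + T, up to the truncation order: the composite
    solves the differential equation (1 + T) F' = F, which determines its
    coefficients recursively from the first one. *)
Lemma comp_exp_log_coef M i : (i <= M)%N ->
  (E M.+1 \Po log_poly M)`_i = (1 + 'X : {poly Cp})`_i.
Proof.
set F := E M.+1 \Po log_poly M.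
have rec j : (j < M)%N -> F`_j.+1 * j.+1%:R = F`_j * (1 - j%:R).
  move=> jM; have := comp_exp_log_deriv M j jM; rewrite -/F.
  rewrite mulrDl mul1r coefD coefXM !coef_deriv mulr_natr => e.
  apply/eqP; rewrite mulrBr mulr1 -[X in X - _]e; apply/eqP.
  by case: j {e jM} => [|j] /=; rewrite ?mulr0 ?addr0 ?subr0// mulr_natr addrK.
have F0 : F`_0 = 1.
  rewrite -horner_coef0 horner_comp /log_poly hornerM hornerX mul0r horner_coef0.
  by rewrite coef_poly expr0 fact0 divr1.
have nz k : (0 < k)%N -> k%:R != 0 :> Cp by exact: natr_padic_neq0.
clearbody F; rewrite coefD coef1 coefX; elim: i => [|[|i] IH] iM; first by rewrite F0 addr0.
  by have := rec 0%N iM; rewrite F0 mulr1 mul1r subr0 add0r.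
apply: (mulIf (nz i.+2 isT)); rewrite rec// IH; last exact: ltnW.
by case: i {IH iM} => [|i]; rewrite !add0r ?subrr ?mulr0 !mul0r.
Qed.

Section NearOne.
Variable t : Cp.
Hypothesis t_small : abs t < r.

Let c := r^-1 * abs t.
Let c_ge0 : 0 <= c. Proof. by rewrite mulr_ge0 ?abs_ge0. Qed.
Let c_lt1 : c < 1. Proof. by rewrite /c mulrC ltr_pdivrMr// mul1r. Qed.

Lemma abs_log_term_le n : abs ((-1) ^+ n * t ^+ n.+1 / n.+1%:R) <= abs t * c ^+ n.
Proof.
rewrite -mulrA abs_signM padic_absM absX exprS -mulrA ler_wpM2l ?abs_ge0//.
rewrite exprMn mulrC ler_wpM2r ?exprn_ge0 ?abs_ge0//.
exact: (abs_invr_le p_prime _ _ (abs_nat_ge p_prime _)).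
Qed.

Lemma padic_log_cvg : (fun M => (log_poly M).[t]) @ \oo --> padic_log (1 + t).
Proof.
under eq_cvg do rewrite horner_log_poly.
rewrite /padic_log.
have -> : (fun n => (-1) ^+ n * (1 + t - 1) ^+ n.+1 / n.+1%:R)
        = (fun n => (-1) ^+ n * t ^+ n.+1 / n.+1%:R) :> Cp ^nat.
  by apply/funext => n; rewrite addrAC subrr add0r.
by apply: (padic_series_cvg _ (abs t) c) => //; [exact: abs_ge0|exact: abs_log_term_le].
Qed.

Lemma abs_log_poly_le M : abs (log_poly M).[t] <= abs t.
Proof.
rewrite horner_log_poly; apply: abs_sum_le => [|i _ _]; first exact: abs_ge0.
by rewrite (le_trans (abs_log_term_le i))// ler_piMr ?abs_ge0// exprn_ile1// ltW.
Qed.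

Lemma abs_padic_log_le : abs (padic_log (1 + t)) <= abs t.
Proof. exact: abs_lim_le padic_log_cvg abs_log_poly_le. Qed.

Lemma horner_exp_poly1 M (x : Cp) : (E M).[x] = series (fun n => x ^+ n / n`!%:R) M.
Proof.
rewrite /exp_poly horner_poly /series/= big_mkord.
by apply: eq_bigr => i _; rewrite expr1n div1r mulrC.
Qed.

(** The partial sums of the exponential are 1-Lipschitz on the disc of
    convergence: [x - y] divides [x ^+ n - y ^+ n], and the cofactor has absolute
    value at most [r ^+ n.-1 <= abs n`!%:R]. *)
Lemma exp_poly_lipschitz M (x y : Cp) : abs x <= r -> abs y <= r ->
  abs ((E M).[x] - (E M).[y]) <= abs (x - y).
Proof.
move=> xr yr; rewrite !horner_poly -sumrB.
apply: abs_sum_le => [|i _ _]; first exact: abs_ge0.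
rewrite -mulrBr subrXX mulrCA padic_absM ler_piMr ?abs_ge0// expr1n div1r.
rewrite padic_absM absV mulrC ler_pdivrMr; last first.
  by rewrite (lt_le_trans _ (abs_fact_ge p_prime _))// exprn_gt0.
rewrite mul1r; apply: le_trans (abs_fact_ge p_prime i).
apply: abs_sum_le => [|j _ _]; first by rewrite exprn_ge0 ?ltW.
rewrite padic_absM !absX.
have -> : r ^+ i.-1 = r ^+ (i.-1 - j) * r ^+ j.
  by rewrite -exprD subnK//; have := ltn_ord j; lia.
have -> : (i.-1 - j = i - j.+1)%N by lia.
by apply: ler_pM; rewrite ?exprn_ge0 ?abs_ge0//; apply: lerXn2r => //; rewrite nnegrE ?abs_ge0// ltW.
Qed.

(** By the Gauss norm estimate, the truncated identity [comp_exp_log_coef] holds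
    at [t] up to a geometrically small error. *)
Lemma comp_exp_log_error M :
  abs ((E M.+1).[(log_poly M).[t]] - (1 + t)) <= c ^+ M.+1.
Proof.
have -> : (E M.+1).[(log_poly M).[t]] - (1 + t) = (E M.+1 \Po log_poly M - (1 + 'X)).[t].
  by rewrite hornerD hornerN horner_comp; congr (_ - _); rewrite !hornerE.
have rV_ge1 := exp_radiusV_ge1 p_prime.
rewrite -[c ^+ _]mul1r; apply: gauss_le_horner_tail => //; first exact: ltW.
  apply: gauss_leB => [|i].
    apply: (gauss_le_comp r^-1 r^-1 1 r) => //; first by rewrite mulVf ?gt_eqF.
      by apply: gauss_le_exp_poly => //; rewrite abs1 mulr1.
    exact: gauss_le_log_poly.
  rewrite mul1r coefD coef1 coefX (@le_trans _ _ 1)//; last exact: exprn_ege1.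
  by apply: absD_le; exact: abs_nat_le1.
by move=> i iM; rewrite coefB comp_exp_log_coef// subrr.
Qed.

(** The partial sums of the exponential at log(1 + t) are close to their values
    at [(log_poly M).[t]], which are close to [1 + t]. *)
Lemma padic_expK : padic_exp (padic_log (1 + t)) = 1 + t.
Proof.
have log_small : abs (padic_log (1 + t)) < r := le_lt_trans abs_padic_log_le t_small.
apply: (padic_cvg_unique _ _ _ (padic_exp_cvg p_prime _ log_small)).
rewrite -cvg_shiftS.
have /cvg_absP lcv := padic_log_cvg.
apply: (cvg_abs_le (fun M => abs ((log_poly M).[t] - padic_log (1 + t)) + c ^+ M.+1)).
  move=> M /=; rewrite -horner_exp_poly1.
  apply: (abs_dist_le_trans (E M.+1).[(log_poly M).[t]]).
    rewrite abs_distC (@le_trans _ _ (abs ((log_poly M).[t] - padic_log (1 + t))))//.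
      apply: exp_poly_lipschitz; last exact: ltW.
      exact: le_trans (abs_log_poly_le M) (ltW t_small).
    by rewrite lerDl exprn_ge0.
  by rewrite (le_trans (comp_exp_log_error M))// lerDr abs_ge0.
rewrite -[0](addr0 0); apply: cvgD => //.
under eq_cvg do rewrite exprS.
exact: cvg_geomR.
Qed.

End NearOne.

Section Qpow.
Variable q : Cp.
Hypothesis q_near1 : abs (1 - q) < r.

Let abs_log_q : abs (padic_log q) < r.
Proof.
have q1 : abs (q - 1) < r by rewrite abs_distC.
by have := abs_padic_log_le _ q1; rewrite addrC subrK => /le_lt_trans; apply.
Qed.

Lemma qpowD (x y : Cp) : abs x <= 1 -> abs y <= 1 ->
  qpow q (x + y) = qpow q x * qpow q y.
Proof.
move=> x1 y1; rewrite /qpow mulrDl padic_expD//.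
  by rewrite padic_absM (le_lt_trans _ abs_log_q)// ler_piMl ?abs_ge0.
by rewrite padic_absM (le_lt_trans _ abs_log_q)// ler_piMl ?abs_ge0.
Qed.

Lemma qpow0 : qpow q 0 = 1.
Proof. by rewrite /qpow mul0r (padic_exp0 p_prime). Qed.

Lemma qpow1 : qpow q 1 = q.
Proof.
have q1 : abs (q - 1) < r by rewrite abs_distC.
by have := padic_expK _ q1; rewrite addrC subrK /qpow mul1r.
Qed.

Lemma qpow_nat m : qpow q m%:R = q ^+ m.
Proof.
elim: m => [|m IH]; first by rewrite qpow0.
by rewrite mulrSr qpowD ?abs_nat_le1 ?abs1// IH qpow1 exprSr.
Qed.

End Qpow.
End PadicLog.

(** * q-integers *)

Section UnitDisc.
Context {R : realType} {p : nat} {Cp : padicComplexType R p}.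
Implicit Types (x y : Cp).
Local Notation abs := (@padic_abs R p Cp).

Lemma abs_distM_le (a a' b b' : Cp) (e : R) : abs b <= 1 -> abs a' <= 1 ->
  abs (a - a') <= e -> abs (b - b') <= e -> abs (a * b - a' * b') <= e.
Proof.
move=> b1 a'1 ae be; have -> : a * b - a' * b' = (a - a') * b + a' * (b - b') by ring.
apply: absD_le; rewrite padic_absM.
  by apply: le_trans ae; rewrite ler_piMr ?abs_ge0.
by apply: le_trans be; rewrite ler_piMl ?abs_ge0.
Qed.

Lemma abs_distX_le x y m : abs x <= 1 -> abs y <= 1 ->
  abs (x ^+ m - y ^+ m) <= abs (x - y).
Proof.
move=> x1 y1; elim: m => [|m IH]; first by rewrite subrr abs0 abs_ge0.
by rewrite !exprS abs_distM_le// absX_le1.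
Qed.

Lemma abs_eq1_near x y : abs x = 1 -> abs (x - y) < 1 -> abs y = 1.
Proof.
move=> x1 xy; have x0 : x != 0 by rewrite -abs_gt0 x1.
have : abs (y / x) = 1 by apply: abs_near1; rewrite -(divff x0) -mulrBl absf x1 divr1.
by rewrite absf x1 divr1.
Qed.

End UnitDisc.

Section Qint.
Context {R : realType} {p : nat} {Cp : padicComplexType R p}.
Implicit Types (x q : Cp) (m n N : nat).
Local Notation abs := (@padic_abs R p Cp).

(** The value of [qnum] at the natural numbers, see [qnum_nat]; this polynomial
    in [q] needs no case distinction at [q = 1]. *)
Definition qint q m : Cp := \sum_(i < m) q ^+ i.

Lemma qint1 q : qint q 1 = 1.
Proof. by rewrite /qint big_ord1. Qed.

Lemma qintD q m n : qint q (m + n) = qint q m + q ^+ m * qint q n.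
Proof.
rewrite /qint big_split_ord/= mulr_sumr; congr (_ + _).
by apply: eq_bigr => i _; rewrite exprD.
Qed.

Lemma qintM q m n : qint q (m * n) = qint q m * qint (q ^+ m) n.
Proof.
elim: n => [|n IH]; first by rewrite muln0 /qint !big_ord0 mulr0.
rewrite mulnSr qintD IH -[in RHS]addn1 qintD qint1 mulr1 -exprM; ring.
Qed.

Lemma subr1_qint q m : 1 - q ^+ m = (1 - q) * qint q m.
Proof. by rewrite -opprB subrX1 -mulNr opprB. Qed.

Lemma qint_inv q m : q != 0 -> qint q^-1 m * q ^+ m = q * qint q m.
Proof.
move=> q0; elim: m => [|m IH]; first by rewrite /qint !big_ord0 mulr0 mul0r.
have -> : qint q m.+1 = 1 + q * qint q m by rewrite -add1n qintD qint1 expr1.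
rewrite -[m.+1]addn1 qintD qint1 mulr1 exprD expr1 mulrDl mulrA IH exprVn.
rewrite mulrA mulVf ?expf_neq0// mul1r; ring.
Qed.

Lemma abs_qint_le1 q m : abs q <= 1 -> abs (qint q m) <= 1.
Proof. by move=> q1; apply: abs_sum_le => // i _ _; rewrite absX_le1. Qed.

Lemma abs_1BX_le q m : abs q <= 1 -> abs (1 - q ^+ m) <= abs (1 - q).
Proof. by move=> q1; rewrite -{1}(expr1n _ m) abs_distX_le ?abs1. Qed.

End Qint.

Section Qnum.
Context {R : realType} {p : nat} {Cp : padicComplexType R p}.
Hypothesis p_prime : prime p.
Local Notation abs := (@padic_abs R p Cp).
Local Notation r := (@exp_radius R p).

Lemma exp_disc_lt1 (q : Cp) : abs (1 - q) < r -> abs (1 - q) < 1.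
Proof. by move=> q1; exact: lt_trans q1 (exp_radius_lt1 p_prime). Qed.

Lemma exp_disc_abs1 (q : Cp) : abs (1 - q) < r -> abs q = 1.
Proof. by move=> q1; apply/abs_near1/exp_disc_lt1. Qed.

Lemma exp_disc_neq0 (q : Cp) : abs (1 - q) < r -> q != 0.
Proof. by move=> q1; rewrite -abs_gt0 exp_disc_abs1. Qed.

Lemma abs_1BV (q : Cp) : abs (1 - q) < r -> abs (1 - q^-1) = abs (1 - q).
Proof.
move=> q1; have q0 := exp_disc_neq0 _ q1.
have -> : 1 - q^-1 = - ((1 - q) / q) by rewrite mulrBl divff// mul1r opprB.
by rewrite absN absf (exp_disc_abs1 _ q1) divr1.
Qed.

Lemma exp_discV (q : Cp) : abs (1 - q) < r -> abs (1 - q^-1) < r.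
Proof. by move=> q1; rewrite abs_1BV. Qed.

Variable q : Cp.
Hypothesis q_near1 : abs (1 - q) < r.
Let q_neq0 := exp_disc_neq0 q q_near1.

Lemma qnum_nat m : qnum q m%:R = qint q m.
Proof.
rewrite /qnum; case: eqVneq => [->|q1].
  by rewrite /qint (eq_bigr (fun=> 1)) ?sumr_const ?card_ord// => i _; rewrite expr1n.
by rewrite qpow_nat// subr1_qint mulrC mulrA mulVf ?mul1r// subr_eq0 eq_sym.
Qed.

(** Although [1 - m] is not a natural number, the functional equation of the
    exponential gives [qpow q^-1 (1 - m%:R)] as the quotient of [q^-1] by
    [q^-1 ^+ m]. *)
Lemma qnumV_1B m : qnum q^-1 (1 - m%:R) = 1 - qint q m.
Proof.
have qV_near1 := exp_discV _ q_near1.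
rewrite /qnum invr_eq1; case: eqVneq => [->|q1].
  by rewrite /qint (eq_bigr (fun=> 1)) ?sumr_const ?card_ord// => i _; rewrite expr1n.
have -> : qpow q^-1 (1 - m%:R) = q^-1 * q ^+ m.
  apply: (mulIf (expf_neq0 m (invr_neq0 q_neq0))).
  rewrite -[in LHS](qpow_nat p_prime _ qV_near1) -qpowD ?abs_nat_le1//; last first.
    by rewrite absB_le ?abs1 ?abs_nat_le1.
  by rewrite subrK qpow1// exprVn mulfK ?expf_neq0.
have q1' : 1 - q != 0 by rewrite subr_eq0 eq_sym.
have q1'' : q - 1 != 0 by rewrite subr_eq0.
apply: (mulIf (_ : 1 - q^-1 != 0)); first by rewrite subr_eq0 eq_sym invr_eq1.
rewrite divfK ?subr_eq0 1?eq_sym ?invr_eq1//.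
have : q ^+ m = 1 - (1 - q) * qint q m by rewrite -subr1_qint subKr.
by move=> ->; field.
Qed.

(** Since [p ^ N] is a product of [N] factors [p], so is the corresponding
    q-integer, with factors [qint x p] where [x] is a power of [q], all of which
    have absolute value at most [qint_ratio]. *)
Definition qint_ratio : R := Num.max p%:R^-1 (abs (1 - q)).

Lemma qint_ratio_lt1 : qint_ratio < 1.
Proof. by rewrite gt_max invf_lt1 ?ltr0n ?ltr1n ?prime_gt0 ?prime_gt1// exp_disc_lt1. Qed.

Lemma qint_ratio_ge0 : 0 <= qint_ratio.
Proof. by rewrite le_max abs_ge0 orbT. Qed.

Let abs_q_le1 : abs q <= 1. Proof. by rewrite exp_disc_abs1. Qed.

Lemma abs_qint_expn_le N : abs (qint q (p ^ N)) <= qint_ratio ^+ N.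
Proof.
elim: N => [|N IH]; first by rewrite qint1 abs1.
rewrite expnSr qintM padic_absM exprSr ler_pM ?abs_ge0//.
have -> : qint (q ^+ (p ^ N)) p =
    p%:R + \sum_(i < p) ((q ^+ (p ^ N)) ^+ i - 1).
  by rewrite sumrB sumr_const card_ord addrC subrK.
apply: absD_le; first by rewrite padic_abs_p le_max lexx.
apply: abs_sum_le => [|i _ _]; first exact: qint_ratio_ge0.
by rewrite abs_distC -exprM (le_trans (abs_1BX_le _ _ _))// le_max lexx orbT.
Qed.

Lemma abs_1B_expn_le N : abs (1 - q ^+ (p ^ N)) <= qint_ratio ^+ N.
Proof.
rewrite subr1_qint padic_absM (le_trans _ (abs_qint_expn_le N))// ler_piMl ?abs_ge0//.
exact/ltW/exp_disc_lt1.
Qed.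

End Qnum.

(** * Alternating sums over intervals of length a power of p *)

Section AlternatingSum.
Context {R : realType} {p : nat} {Cp : padicComplexType R p}.
Implicit Types (g : nat -> Cp) (P m n N : nat) (e d : R).
Local Notation abs := (@padic_abs R p Cp).

Definition altsum g n : Cp := \sum_(0 <= x < n) (-1) ^+ x * g x.

Lemma altsum0 g : altsum g 0 = 0.
Proof. by rewrite /altsum big_geq. Qed.

Lemma altsumS g n : altsum g n.+1 = altsum g n + (-1) ^+ n * g n.
Proof. by rewrite /altsum big_nat_recr. Qed.

Lemma altsumD g m n :
  altsum g (m + n) = altsum g m + (-1) ^+ m * altsum (fun x => g (m + x)%N) n.
Proof.
elim: n => [|n IH]; first by rewrite addn0 /altsum [in X in _ * X]big_geq// mulr0 addr0.
by rewrite addnS !altsumS IH exprD; ring.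
Qed.

Lemma altsum_dist_le g g' n e : 0 <= e ->
  (forall x, (x < n)%N -> abs (g x - g' x) <= e) -> abs (altsum g n - altsum g' n) <= e.
Proof.
move=> e0 ge; rewrite /altsum -sumrB; apply: abs_sum_le => // x.
by rewrite mem_index_iota => /= xn _; rewrite -mulrBr abs_signM ge.
Qed.

(** Cut the sum into [j] blocks of odd length [P]: the signs of the blocks
    alternate, and all blocks have approximately the same sum, so that they
    cancel in pairs. *)
Lemma altsum_blocks g P e : odd P -> 0 <= e ->
    (forall x, abs (g (x + P)%N - g x) <= e) ->
  forall j, abs (altsum g (P * j) - (odd j)%:R * altsum g P) <= e.
Proof.
move=> oddP e0 ge.
have shift j x : abs (g (P * j + x)%N - g x) <= e.
  elim: j => [|j IH]; first by rewrite muln0 subrr abs0.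
  apply: (abs_dist_le_trans (g (P * j + x)%N)) => //.
  have -> : (P * j.+1 + x = P * j + x + P)%N by rewrite mulnS; lia.
  exact: ge.
elim=> [|j IH]; first by rewrite muln0 mul0r subr0 /altsum big_geq// abs0.
rewrite mulnSr altsumD.
have -> : (odd j.+1)%:R = (odd j)%:R + (-1) ^+ (P * j) :> Cp.
  by rewrite -signr_odd oddM oddP /=; case: (odd j); rewrite ?expr1 ?subrr ?expr0 ?add0r.
have -> : altsum g (P * j) + (-1) ^+ (P * j) * altsum (fun x => g (P * j + x)%N) P
    - ((odd j)%:R + (-1) ^+ (P * j)) * altsum g P
  = (altsum g (P * j) - (odd j)%:R * altsum g P)
    + (-1) ^+ (P * j) * (altsum (fun x => g (P * j + x)%N) P - altsum g P) by ring.
by apply: absD_le; rewrite ?abs_signM//; apply: altsum_dist_le.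
Qed.

(** The form of uniform continuity on Z_p of a function of absolute value at most
    1, known only on the natural numbers, that makes its alternating sums over
    [0, p ^ N[ converge. *)
Definition padic_lip d g :=
  (forall x, abs (g x) <= 1) /\ (forall N x, abs (g (x + p ^ N)%N - g x) <= d ^+ N).

Lemma padic_lip_cvg d g : odd p -> 0 <= d -> d < 1 -> padic_lip d g ->
  cvgn (fun N => altsum g (p ^ N)).
Proof.
move=> podd d0 d1 [_ glip].
apply: (padic_cvg_of_consecutive _ 1 d) => // N; rewrite mul1r expnSr.
have := altsum_blocks g (p ^ N) (d ^+ N) _ (exprn_ge0 N d0) (glip N) p.
by rewrite podd mul1r; apply; rewrite oddX podd orbT.
Qed.

Lemma padic_lipM d g g' : padic_lip d g -> padic_lip d g' ->
  padic_lip d (fun x => g x * g' x).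
Proof.
move=> [g1 glip] [g'1 g'lip]; split=> [x|N x]; first exact: absM_le1.
exact: abs_distM_le.
Qed.

Lemma padic_lipX d g m : padic_lip d g -> padic_lip d (fun x => g x ^+ m).
Proof.
move=> [g1 glip]; split=> [x|N x]; first exact: absX_le1.
exact: le_trans (abs_distX_le _ _ _ (g1 _) (g1 _)) (glip N x).
Qed.

Lemma padic_lip_1B d g : padic_lip d g -> padic_lip d (fun x => 1 - g x).
Proof.
move=> [g1 glip]; split=> [x|N x]; first by rewrite absB_le ?abs1.
by rewrite opprB addrC subrKA abs_distC.
Qed.

(** The values [P.+1 - x] run over [2, P + 2[ ; both this reflection and the move
    to [0, P[ use that [P] is odd to keep track of the signs. *)
Lemma altsum_rev g P : odd P ->
  altsum (fun x => g (P.+1 - x)%N) P = altsum g P - g 0%N + g 1%N - g P + g P.+1.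
Proof.
move=> oddP.
have -> : altsum (fun x => g (P.+1 - x)%N) P = altsum (fun x => g (2 + x)%N) P.
  rewrite /altsum big_nat_rev/= !big_mkord; apply: eq_bigr => x _.
  have xP := ltn_ord x.
  rewrite add0n; congr (_ * g _); last by lia.
  rewrite -signr_odd -[RHS]signr_odd oddB// oddP/=.
  by rewrite negbK.
have sP : (-1) ^+ P = -1 :> Cp by rewrite -signr_odd oddP expr1.
have := altsumD g 2 P; rewrite add2n !altsumS altsum0 exprS sP => e.
have -> : altsum g P - g 0%N + g 1%N - g P + g P.+1
  = altsum g P + -1 * g P + -1 * -1 * g P.+1 - g 0%N + g 1%N by ring.
by rewrite e; ring.
Qed.

End AlternatingSum.

(** * The reflection x = 1 - y *)

Section Reflection.
Context {R : realType} {p : nat} {Cp : padicComplexType R p}.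
Hypotheses (p_prime : prime p) (p_odd : odd p).
Local Notation abs := (@padic_abs R p Cp).
Local Notation r := (@exp_radius R p).
Variable q : Cp.
Hypothesis q_near1 : abs (1 - q) < r.
Local Notation d := (qint_ratio q).

Let q_neq0 := exp_disc_neq0 p_prime q q_near1.
Let abs_q : abs q = 1 := exp_disc_abs1 p_prime q q_near1.
Let d_ge0 : 0 <= d := qint_ratio_ge0 q.
Let abs_q_le1 : abs q <= 1. Proof. by rewrite abs_q. Qed.
Let odd_expn N : odd (p ^ N). Proof. by rewrite oddX p_odd orbT. Qed.

Lemma padic_lip_exp h : padic_lip d (fun x => q ^+ (h * x)).
Proof.
have lip1 : padic_lip d (fun x => q ^+ x).
  split=> [x|N x]; first exact: absX_le1.
  rewrite exprD -{2}[q ^+ x]mulr1 -mulrBr padic_absM absX abs_q expr1n mul1r abs_distC.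
  exact: abs_1B_expn_le.
have -> : (fun x => q ^+ (h * x)) = (fun x => (q ^+ x) ^+ h).
  by apply/funext => x; rewrite -exprM mulnC.
exact: padic_lipX.
Qed.

Lemma padic_lip_qint : padic_lip d (qint q).
Proof.
split=> [x|N x]; first exact: abs_qint_le1.
rewrite qintD addrAC subrr add0r padic_absM absX abs_q expr1n mul1r.
exact: abs_qint_expn_le.
Qed.

Definition reflected_term h m x : Cp := q ^+ (h * x) * (1 - qint q x) ^+ m.

Lemma padic_lip_reflected_term h m : padic_lip d (reflected_term h m).
Proof.
apply: padic_lipM; first exact: padic_lip_exp.
by apply/padic_lipX/padic_lip_1B/padic_lip_qint.
Qed.

(** The two quantities differ by multiples of [1 - q ^+ P] and [qint q P] with
    [P = p ^ N], both p-adically small: these are the errors made when [P.+1 - y]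
    replaces [1 - y] in a power of [q] and in a q-integer. *)
Lemma reflected_term_near h m N y : (y < p ^ N)%N ->
  abs (reflected_term h m ((p ^ N).+1 - y)
       - q ^+ h * (q^-1 ^+ (h * y) * qint q^-1 y ^+ m)) <= d ^+ N.
Proof.
move=> yP; set P := (p ^ N)%N in yP *; set z := (P.+1 - y)%N.
have zy : (z + y = P.+1)%N by rewrite subnK// ltnW// ltnS ltnW.
have abs_qV_le1 : abs q^-1 <= 1 by rewrite absV abs_q invr1.
have qz : q ^+ z = q ^+ P * q * q^-1 ^+ y.
  by rewrite exprVn -exprSr -zy exprD mulfK// expf_neq0.
have bracket : 1 - qint q z = q ^+ P * qint q^-1 y - q * qint q P.
  have -> : qint q^-1 y = q * qint q y * q^-1 ^+ y.
    by rewrite -qint_inv// exprVn mulfK// expf_neq0.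
  have e : qint q z + q ^+ z * qint q y = 1 + q * qint q P.
    by rewrite -qintD zy -add1n qintD qint1 expr1.
  have -> : qint q z = 1 + q * qint q P - q ^+ z * qint q y by rewrite -e addrK.
  by rewrite qz; ring.
have qP1 : abs (q ^+ P - 1) <= d ^+ N by rewrite abs_distC abs_1B_expn_le.
rewrite mulrA; apply: abs_distM_le.
- by rewrite absX_le1// absB_le ?abs1// abs_qint_le1.
- by rewrite absM_le1// absX_le1.
- rewrite mulnC exprM [(h * y)%N]mulnC exprM -exprMn.
  apply: le_trans (abs_distX_le _ _ _ _ _) _; rewrite ?absX_le1 ?absM_le1 ?absX_le1//.
  have -> : q ^+ z - q * q^-1 ^+ y = (q ^+ P - 1) * (q * q^-1 ^+ y) by rewrite qz; ring.
  by rewrite padic_absM (le_trans _ qP1)// ler_piMr ?abs_ge0// absM_le1// absX_le1.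
- apply: le_trans (abs_distX_le _ _ _ _ _) _; rewrite ?abs_qint_le1//.
    by rewrite absB_le ?abs1// abs_qint_le1.
  have -> : 1 - qint q z - qint q^-1 y = (q ^+ P - 1) * qint q^-1 y - q * qint q P.
    by rewrite bracket; ring.
  apply: absB_le; rewrite padic_absM.
    by rewrite (le_trans _ qP1)// ler_piMr ?abs_ge0// abs_qint_le1.
  by rewrite abs_q mul1r abs_qint_expn_le.
Qed.

(** Reverse the sum by [altsum_rev]; of its four boundary terms, the last two are
    close to [g 0 = 1] and [g 1 = 0], which are the first two.  The value
    [g 1 = 0] is where [m] must be positive. *)
Lemma altsum_reflection h m N : (0 < m)%N ->
  abs (q ^+ h * altsum (fun y => q^-1 ^+ (h * y) * qint q^-1 y ^+ m) (p ^ N)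
       - (altsum (reflected_term h m) (p ^ N) - 2%:R)) <= d ^+ N.
Proof.
move=> m0; set P := (p ^ N)%N; set g := reflected_term h m.
have [_ glip] := padic_lip_reflected_term h m.
have g0 : g 0%N = 1 by rewrite /g /reflected_term muln0 /qint big_ord0 subr0 !expr1n mul1r.
have g1 : g 1%N = 0 by rewrite /g /reflected_term qint1 subrr expr0n gtn_eqF// mulr0.
apply: (abs_dist_le_trans (altsum (fun x => g (P.+1 - x)%N) P)).
  have -> : q ^+ h * altsum (fun y => q^-1 ^+ (h * y) * qint q^-1 y ^+ m) P
          = altsum (fun y => q ^+ h * (q^-1 ^+ (h * y) * qint q^-1 y ^+ m)) P.
    by rewrite /altsum mulr_sumr; apply: eq_bigr => y _; rewrite mulrCA.
  rewrite abs_distC; apply: altsum_dist_le => [|y yP]; first exact: exprn_ge0.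
  exact: reflected_term_near.
rewrite (altsum_rev g P (odd_expn N)) g0 g1.
have -> : altsum g P - 1 + 0 - g P + g P.+1 - (altsum g P - 2%:R)
        = (g (1 + P)%N - g 1%N) - (g (0 + P)%N - g 0%N) by rewrite g0 g1 add0n add1n; ring.
by apply: absB_le; exact: glip.
Qed.

(** Uniform continuity gives the first limit, and [altsum_reflection] carries it
    over to the second sum. *)
Lemma cvg_altsum_reflection h m : (0 < m)%N -> exists l,
  (fun N => altsum (reflected_term h m) (p ^ N)) @ \oo --> l /\
  (fun N => q ^+ h * altsum (fun y => q^-1 ^+ (h * y) * qint q^-1 y ^+ m) (p ^ N))
    @ \oo --> l - 2%:R.
Proof.
move=> m0; have d_lt1 : d < 1 by exact: qint_ratio_lt1.
have /cvg_ex[l gl] := padic_lip_cvg _ _ p_odd d_ge0 d_lt1 (padic_lip_reflected_term h m).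
exists l; split=> //.
have /cvg_absP gl' := gl.
apply: (cvg_abs_le (fun N => d ^+ N + abs (altsum (reflected_term h m) (p ^ N) - l))).
  move=> N; apply: (abs_dist_le_trans (altsum (reflected_term h m) (p ^ N) - 2%:R)).
    by rewrite (le_trans (altsum_reflection h m N m0))// lerDl abs_ge0.
  by rewrite opprB addrA subrK lerDr exprn_ge0.
rewrite -[0](addr0 0); apply: cvgD => //.
by have := cvg_geomR 1 d d_ge0 d_lt1; under eq_cvg do rewrite mul1r.
Qed.

End Reflection.

(** * Fermionic integrals *)

Section Integral.
Context {R : realType} {p : nat} {Cp : padicComplexType R p}.
Hypotheses (p_prime : prime p) (p_odd : odd p).
Local Notation abs := (@padic_abs R p Cp).
Local Notation r := (@exp_radius R p).

Let two_neq0 : 2%:R != 0 :> Cp. Proof. exact: natr_padic_neq0. Qed.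

Let abs2 : abs 2%:R = 1.
Proof. by apply: abs_nat_coprime => //; rewrite coprime_sym coprime2n. Qed.

(** Since [p ^ N] is odd and [q ^+ (p ^ N)] tends to 1, the normalizing factor
    of the fermionic sums tends to [(1 + q) / 2]. *)
Lemma cvg_fermionic_sum (q : Cp) (f : Cp -> Cp) (g : nat -> Cp) (l : Cp) :
    abs (1 - q) < r -> (forall x, f x%:R * q ^+ x = g x) ->
    (fun N => altsum g (p ^ N)) @ \oo --> l ->
  fermionic_sum q f @ \oo --> (1 + q) / 2%:R * l.
Proof.
move=> q_near1 fg gl.
pose d := qint_ratio q; have d0 : 0 <= d := qint_ratio_ge0 q.
have d1 : d < 1 by exact: qint_ratio_lt1.
have abs_1DX m : abs (1 + q ^+ m) = 1.
  apply: (abs_eq1_near 2%:R) => //.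
  have -> : 2%:R - (1 + q ^+ m) = 1 - q ^+ m by ring.
  apply: le_lt_trans (exp_disc_lt1 p_prime _ q_near1); apply: abs_1BX_le.
  by rewrite (exp_disc_abs1 p_prime).
have nz m : 1 + q ^+ m != 0 by rewrite -abs_gt0 abs_1DX.
have normE N : (qnum_neg q (p ^ N))^-1 = (1 + q) * (1 + q ^+ (p ^ N))^-1.
  rewrite /qnum_neg exprNn -signr_odd oddX p_odd orbT expr1 mulN1r opprK invf_div.
  by rewrite mulrC.
have inv_cvg : (fun N => (1 + q ^+ (p ^ N))^-1) @ \oo --> (2%:R : Cp)^-1.
  apply: (cvg_abs_le (fun N => 1 * d ^+ N)); last exact: cvg_geomR.
  move=> N; rewrite mul1r.
  have -> : (1 + q ^+ (p ^ N))^-1 - 2%:R^-1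
          = (1 - q ^+ (p ^ N)) / ((1 + q ^+ (p ^ N)) * 2%:R).
    by field; rewrite two_neq0 nz.
  by rewrite absf padic_absM abs2 abs_1DX mulr1 divr1 abs_1B_expn_le.
have inv_le1 N : abs (1 + q ^+ (p ^ N))^-1 <= 1 by rewrite absV abs_1DX invr1.
have := padic_cvgMl (1 + q) _ _ (padic_cvgM _ _ _ _ inv_le1 inv_cvg gl).
rewrite mulrA; apply: cvg_trans; apply: near_eq_cvg; apply: nearW => N.
rewrite /fermionic_sum normE mulrA /altsum; congr (_ * _).
by apply: eq_bigr => x _; rewrite -fg mulrA.
Qed.

(** By [qnumV_1B], the integrand is [reflected_term] up to the factor [q ^+ x] of
    the measure.  The limit of its alternating sums is that of the sums in the
    Genocchi number, times [q ^+ h], plus 2; normalized by [(1 + q) / 2], this 2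
    becomes the summand [qnum q 2%:R]. *)
Lemma cvg_fermionic_reflected_power (q : Cp) (h m : nat) :
    abs (1 - q) < r -> (0 < h)%N -> (0 < m)%N ->
  fermionic_sum q (fun x => qnum q^-1 (1 - x) ^+ m * qpow q ((h%:R - 1) * x)) @ \oo -->
    qnum q 2%:R + q ^+ h.+1 / (m + 1)%:R * genocchi h q^-1 (m + 1).
Proof.
move=> q_near1 h0 m0.
have qV_near1 := exp_discV p_prime _ q_near1.
have q0 := exp_disc_neq0 p_prime _ q_near1.
have [l [gl g'l]] := cvg_altsum_reflection p_prime p_odd _ q_near1 h m m0.
have hE x : (h%:R - 1) * x%:R = (h.-1 * x)%:R :> Cp.
  by rewrite natrM -subn1 natrB.
have hX (z : Cp) x : z ^+ (h.-1 * x) * z ^+ x = z ^+ (h * x).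
  by rewrite -exprD -mulSnr prednK.
have g'l' : (fun N => altsum (fun y => q^-1 ^+ (h * y) * qint q^-1 y ^+ m) (p ^ N))
    @ \oo --> q ^- h * (l - 2%:R).
  have := padic_cvgMl (q ^- h) _ _ g'l; apply: cvg_trans.
  by apply: near_eq_cvg; apply: nearW => N /=; rewrite mulrA mulVf ?mul1r// expf_neq0.
have genE : genocchi h q^-1 (m + 1)
    = (m + 1)%:R * ((1 + q^-1) / 2%:R * (q ^- h * (l - 2%:R))).
  rewrite /genocchi addn1 /=; congr (_ * _); apply: padic_cvg_lim.
  apply: (cvg_fermionic_sum _ _ _ _ qV_near1 _ g'l') => x.
  by rewrite hE add0r qpow_nat// qnum_nat// mulrAC hX.
have m1 : (m + 1)%:R != 0 :> Cp by rewrite natr_padic_neq0// addn1.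
have -> : qnum q 2%:R + q ^+ h.+1 / (m + 1)%:R * genocchi h q^-1 (m + 1)
        = (1 + q) / 2%:R * l.
  rewrite genE qnum_nat// /qint !big_ord_recl big_ord0 /= addr0 expr0 expr1 exprS.
  have qh0 : q ^+ h != 0 by rewrite expf_neq0.
  by move: (m + 1)%:R m1 => b b0; field; rewrite two_neq0 qh0 q0 b0.
apply: (cvg_fermionic_sum _ _ _ _ q_near1 _ gl) => x.
by rewrite hE qpow_nat// qnumV_1B// -mulrA hX mulrC.
Qed.

End Integral.

Section BernsteinProduct.
Context {R : realType} {p : nat} {Cp : padicComplexType R p}.
Hypothesis p_prime : prime p.
Local Notation abs := (@padic_abs R p Cp).
Local Notation r := (@exp_radius R p).

(** With [y = 1 - qint q m], expand the power [(1 - y) ^+ (s * k)] coming from the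
    factors [qnum q m%:R].  If some [n i < k], a binomial coefficient vanishes on
    both sides; otherwise the subtractions [n i - k] are not truncated. *)
Lemma prod_bernstein_expand (q : Cp) (s k m : nat) (n : 'I_s -> nat) :
    abs (1 - q) < r ->
  \prod_(i < s) bernstein k (n i) m%:R q =
  (\prod_(i < s) 'C(n i, k)%:R) * \sum_(0 <= l < (s * k).+1)
    'C(s * k, l)%:R * (-1) ^+ (s * k + l) *
      qnum q^-1 (1 - m%:R) ^+ ((\sum_(i < s) n i) - l).
Proof.
move=> q_near1.
have [i0 ni0k|nk] := pickP (fun i => (n i < k)%N).
  by rewrite (bigD1 i0)//= /bernstein bin_small// !mul0r (bigD1 i0)//= bin_small// !mul0r.
have kn i : (k <= n i)%N by rewrite leqNgt nk.
have sk : (s * k = \sum_(i < s) k)%N by rewrite sum_nat_const card_ord.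
have skN : (s * k <= \sum_(i < s) n i)%N by rewrite sk leq_sum.
rewrite /bernstein; under eq_bigr do rewrite qnum_nat// qnumV_1B//.
rewrite qnumV_1B//; set y := 1 - qint q m.
have -> : qint q m = 1 - y by rewrite subKr.
rewrite !big_split/= -mulrA !prodrXr sumnB// -sk; congr (_ * _).
rewrite [1 - y]addrC exprDn big_mkord mulr_suml; apply: eq_bigr => l _.
have lsk : (l <= s * k)%N by rewrite -ltnS.
rewrite expr1n mulr1 [(- y) ^+ _]exprNn -[X in X * _ = _]mulr_natl -!mulrA; congr (_ * _).
have -> : (-1) ^+ (s * k + l) = (-1) ^+ (s * k - l) :> Cp.
  by rewrite -{1}(subnK lsk) -addnA exprD addnn -mul2n exprM sqrrN !expr1n mulr1.
by congr (_ * _); rewrite -exprD; rewrite addnC addnBA ?subnK.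
Qed.

End BernsteinProduct.

Theorem theorem9 (R : realType) (p : nat) (Cp : padicComplexType R p)
  (p_prime : prime p) (p_odd : odd p)
  (q : Cp) (q_near1 : padic_abs (1 - q) < p%:R `^ (- (p%:R - 1)^-1))
  (h : nat) (h_gt0 : (0 < h)%N)
  (s : nat) (s_ge2 : (2 <= s)%N)
  (n : 'I_s -> nat) (k : nat)
  (n_gt : (s * k < \sum_(i < s) n i)%N) :
  let N := (\sum_(i < s) n i)%N in
  let F := fun x : Cp =>
    (\prod_(i < s) bernstein k (n i) x q) * qpow q ((h%:R - 1) * x) in
  cvgn (fermionic_sum q F) /\
  fermionic_integral q F =
    if k == 0%N then
      qnum q 2%:R + q ^+ h.+1 / (N + 1)%:R * genocchi h q^-1 (N + 1)
    else
      (\prod_(i < s) 'C(n i, k)%:R) *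
      \sum_(0 <= l < (s * k).+1)
        'C(s * k, l)%:R * (-1) ^+ (s * k + l) *
        (qnum q 2%:R
         + q ^+ h.+1 / (N - l + 1)%:R * genocchi h q^-1 (N - l + 1)).
Proof.
move=> N F.
pose binoms : Cp := \prod_(i < s) 'C(n i, k)%:R.
pose coef l : Cp := 'C(s * k, l)%:R * (-1) ^+ (s * k + l).
pose G m := qnum q 2%:R + q ^+ h.+1 / (m + 1)%:R * genocchi h q^-1 (m + 1).
pose f l x : Cp := qnum q^-1 (1 - x) ^+ (N - l) * qpow q ((h%:R - 1) * x).
have Fsum : fermionic_sum q F =
    (fun M => binoms * \sum_(0 <= l < (s * k).+1) coef l * fermionic_sum q (f l) M).
  apply/funext => M; rewrite /fermionic_sum.
  under [in RHS]eq_bigr do rewrite mulrCA mulr_sumr.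
  rewrite -mulr_sumr mulrCA; congr (_ * _); rewrite exchange_big/= mulr_sumr.
  apply: eq_bigr => x _; rewrite /F prod_bernstein_expand// -/binoms -/N.
  rewrite -!mulrA mulrCA; congr (_ * _); rewrite !mulr_suml mulr_sumr.
  by apply: eq_bigr => l _; rewrite /f /coef; ring.
have Fcvg : fermionic_sum q F @ \oo -->
    binoms * \sum_(0 <= l < (s * k).+1) coef l * G (N - l)%N.
  rewrite Fsum; apply/padic_cvgMl/padic_cvg_sum => l.
  rewrite mem_index_iota ltnS => /= lsk; apply: padic_cvgMl.
  apply: cvg_fermionic_reflected_power => //.
  by rewrite subn_gt0 (leq_ltn_trans lsk).
split; first by apply/cvg_ex; eexists; exact: Fcvg.
rewrite /fermionic_integral (padic_cvg_lim _ _ Fcvg); case: eqP => // k0.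
(* for [k = 0] the sum over [l] has a single term, with coefficient 1 *)
rewrite /binoms /coef big1 => [|i _]; last by rewrite k0 bin0.
by rewrite k0 muln0 big_nat1 bin0 expr0 subn0 !mul1r.
Qed.
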